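(* Let $k$ be an integer $>1$, put $n:=3k$, $N:=\{1,\ldots,n\}$, $P_{nk}:=\{X\subseteq N\mid k\text{ divides }|X|\}$, and $B':=N\setminus B$ for all $B\subseteq N$; let $\mathbf P_{nk}:=(P_{nk},\subseteq,{}',\emptyset,N)$ (an orthomodular poset). Let $Q$ denote the set of $k$-element subsets of $N$, put $P_B:=\{C\in P_{nk}\mid C\supseteq B\text{ or }C\subseteq B'\}$ and $\mathbf P_B:=(P_B,\subseteq,{}',\emptyset,N)$ for all $B\in Q$, and let $A\in Q$. Then (i) $\mathbf P_A$ is a maximal orthomodular sublattice of the orthomodular poset $\mathbf P_{nk}$; (ii) $|P_A|=4+2\binom{2k}{k}$; (iii) $\mathbf P_A$ is the atomic pasting of $\binom{2k}{k}/2$ eight-element Boolean algebras via the atom $A$; (iv) the $\mathbf P_B$, $B\in Q$, are pairwise distinct.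
   Context: An orthoposet is a tuple $(P,\leq,{}',0,1)$ where $(P,\leq,0,1)$ is a bounded poset and ${}'$ is a unary operation on $P$ such that $x\leq y$ implies $y'\leq x'$, $x''=x$, and for every $x$ the supremum $x\vee x'$ exists and equals $1$ and the infimum $x\wedge x'$ exists and equals $0$. Elements $x,y$ are orthogonal, $x\perp y$, if $x\leq y'$. An orthomodular poset is an orthoposet in which the supremum $x\vee y$ exists whenever $x\perp y$ and in which $x\leq y$ implies $x\vee(x\vee y')'=y$; an orthomodular lattice is an orthomodular poset that is a lattice. An orthomodular sublattice of an orthomodular poset $\mathbf P$ is a subset $S\subseteq P$ with $0,1\in S$, closed under ${}'$ and under suprema (taken in $\mathbf P$) of orthogonal elements, such that $S$ with the induced order is a lattice, the lattice operations being those of the induced order of $S$ (they need not be suprema and infima in $\mathbf P$). With the restricted ${}'$ it is then an orthomodular lattice. It is maximal if it is not properly contained in another orthomodular sublattice of $\mathbf P$. An orthomodular lattice $M$ is the atomic pasting of a family of Boolean algebras $M_i$ ($i\in I$) via the atom $p$ if the $M_i$ are Boolean subalgebras of $M$ (with the same $0,1,{}',\vee,\wedge$), $p$ is an atom of every $M_i$, $M=\bigcup_{i\in I}M_i$, $M_i\cap M_j=\{0,p,p',1\}$ for $i\neq j$, and $x\leq y$ in $M$ if and only if $x\leq y$ in some $M_i$ containing both $x$ and $y$. *)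

(* Defs.v *)
From mathcomp Require Import all_boot.

Set Implicit Arguments.
Unset Strict Implicit.
Unset Printing Implicit Defensive.

(* A tuple (P, <=, ', 0, 1). The universe P is a subset of an ambient type T;
   the values of the order and of ' outside P are irrelevant. Suprema and
   infima are relations, since they need not exist and depend on P. *)
Record ostruct (T : Type) := OStruct {
  car : {pred T};
  ole : rel T;
  ocompl : T -> T;
  obot : T;
  otop : T }.

Definition restr (T : Type) (P : ostruct T) (S : {pred T}) : ostruct T :=
  OStruct S (ole P) (ocompl P) (obot P) (otop P).

Section Notions.
Variable T : Type.
Implicit Types (P M L : ostruct T) (S : {pred T}) (x y z p : T).

Definition is_sup P x y z : Prop :=
  [/\ z \in car P, ole P x z, ole P y z &
      forall w, w \in car P -> ole P x w -> ole P y w -> ole P z w].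

Definition is_inf P x y z : Prop :=
  [/\ z \in car P, ole P z x, ole P z y &
      forall w, w \in car P -> ole P w x -> ole P w y -> ole P w z].

Definition is_poset P : Prop :=
  [/\ {in car P, reflexive (ole P)},
      {in car P &, antisymmetric (ole P)} &
      {in car P & &, transitive (ole P)}].

Definition is_bounded_poset P : Prop :=
  [/\ is_poset P, obot P \in car P, otop P \in car P &
      forall x, x \in car P -> ole P (obot P) x /\ ole P x (otop P)].

Definition has_lattice_ops P : Prop :=
  forall x y, x \in car P -> y \in car P ->
    (exists z, is_sup P x y z) /\ (exists z, is_inf P x y z).

Definition is_complementation P : Prop :=
  forall x, x \in car P ->
    [/\ ocompl P x \in car P,
        is_sup P x (ocompl P x) (otop P) & is_inf P x (ocompl P x) (obot P)].

Definition is_orthoposet P : Prop :=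
  [/\ is_bounded_poset P,
      is_complementation P,
      {in car P &, forall x y, ole P x y -> ole P (ocompl P y) (ocompl P x)} &
      {in car P, involutive (ocompl P)}].

Definition orthogonal P x y : Prop := ole P x (ocompl P y).

Definition is_orthomodular_poset P : Prop :=
  [/\ is_orthoposet P,
      {in car P &, forall x y, orthogonal P x y -> exists z, is_sup P x y z} &
      {in car P &, forall x y, ole P x y ->
         exists2 z, is_sup P x (ocompl P y) z & is_sup P x (ocompl P z) y}].

Definition is_orthomodular_lattice P : Prop :=
  is_orthomodular_poset P /\ has_lattice_ops P.

(* Suprema of orthogonal elements are those of P, whereas the lattice
   operations are those of the induced order of S. *)
Definition is_om_sublattice P S : Prop :=
  is_orthomodular_poset P /\
  [/\ {subset S <= car P},
      obot P \in S /\ otop P \in S,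
      {in S, forall x, ocompl P x \in S},
      {in S &, forall x y, orthogonal P x y ->
         forall z, is_sup P x y z -> z \in S} &
      has_lattice_ops (restr P S)].

Definition is_maximal_om_sublattice P S : Prop :=
  is_om_sublattice P S /\
  forall S' : {pred T}, is_om_sublattice P S' -> {subset S <= S'} ->
    S' =i S.

Definition is_distributive P : Prop :=
  forall x y z, x \in car P -> y \in car P -> z \in car P ->
  forall yz xy xz l r,
    is_sup P y z yz -> is_inf P x yz l ->
    is_inf P x y xy -> is_inf P x z xz -> is_sup P xy xz r ->
    l = r.

Definition is_boolean_algebra P : Prop :=
  [/\ is_bounded_poset P, has_lattice_ops P, is_distributive P &
      is_complementation P].

Definition is_boolean_subalgebra M S : Prop :=
  [/\ {subset S <= car M},
      obot M \in S /\ otop M \in S,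
      {in S, forall x, ocompl M x \in S},
      {in S &, forall x y z, is_sup M x y z \/ is_inf M x y z -> z \in S} &
      is_boolean_algebra (restr M S)].

Definition is_atom P p : Prop :=
  [/\ p \in car P, p <> obot P &
      forall x, x \in car P -> ole P x p -> x = obot P \/ x = p].

Definition is_atomic_pasting M (I : Type) (F : I -> {pred T}) p : Prop :=
  is_orthomodular_lattice M /\
  [/\ forall i, is_boolean_subalgebra M (F i) /\ is_atom (restr M (F i)) p,
      forall x, x \in car M <-> exists i, x \in F i,
      forall i j, i <> j -> forall x,
        (x \in F i) && (x \in F j) <->
        [\/ x = obot M, x = p, x = ocompl M p | x = otop M] &
      forall x y, x \in car M -> y \in car M ->
        (ole M x y <-> exists i, [/\ x \in F i, y \in F i &
                                     ole (restr M (F i)) x y])].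

End Notions.

(* The set {1, ..., n} is represented by 'I_n. *)
Section Concrete.
Variables n k : nat.

Definition set_struct (U : {set {set 'I_n}}) : ostruct {set 'I_n} :=
  @OStruct {set 'I_n} U (fun X Y => X \subset Y) (fun X => ~: X) set0 setT.

Definition Pnk : {set {set 'I_n}} := [set X : {set 'I_n} | k %| #|X|].

Definition Q : {set {set 'I_n}} := [set X : {set 'I_n} | #|X| == k].

Definition PB (B : {set 'I_n}) : {set {set 'I_n}} :=
  [set C : {set 'I_n} in Pnk | (B \subset C) || (C \subset ~: B)].

End Concrete.

(* Main.v *)
(** Write [C = (C :&: A) :|: (C :\: A)].  For [C] in [P_A] the first part is
    empty or [A], and the second is empty, a [k]-subset [D] of [A'], or [A'];
    hence [P_A] is the union of the eight-element algebras generated by the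
    partitions [{A, D, A' \ D}], one for each unordered pair [{D, A' \ D}].
    Fixing a point [a] of [A'], these pairs are indexed by the [D] containing
    [a].  For maximality, if [C] is a [k]-set outside [P_A], then [A' \ C] has
    more than [k] points, so it contains two [k]-sets [D1 <> D2]; their
    supremum would have at least [2k] points and lie below both [A'] and [C'],
    which are distinct [2k]-sets. *)

Require Import Defs.
From mathcomp Require Import all_boot.

Set Implicit Arguments.
Unset Strict Implicit.
Unset Printing Implicit Defensive.

(** * Subsets of prescribed size *)

Lemma exists_subset_card (T : finType) (S : {set T}) m :
  m <= #|S| -> exists2 D : {set T}, D \subset S & #|D| = m.
Proof.
move=> le_m; have: 0 < #|[set D : {set T} | D \subset S & #|D| == m]|.
  by rewrite cards_draws bin_gt0.
by case/card_gt0P=> D; rewrite inE => /andP[sDS /eqP cD]; exists D.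
Qed.

Lemma exists_subset_card_mem (T : finType) (S : {set T}) m x :
  x \in S -> 0 < m <= #|S| ->
  exists D : {set T}, [/\ D \subset S, #|D| = m & x \in D].
Proof.
case: m => // m xS /=; rewrite (cardsD1 x) xS ltnS.
case/exists_subset_card=> D; rewrite subsetD1 => /andP[sDS xD] cD.
by exists (x |: D); rewrite subUset sub1set xS sDS setU11 cardsU1 xD cD.
Qed.

(** * Families of sets ordered by inclusion *)

Section SetStructures.
Variable n : nat.
Implicit Types (U : {set {set 'I_n}}) (x y z : {set 'I_n}).

Lemma is_supU U x y : x :|: y \in U -> is_sup (set_struct U) x y (x :|: y).
Proof.
move=> xyU; split=> //=; rewrite ?subsetUl ?subsetUr // => w _ xw yw.
by rewrite subUset xw.
Qed.

Lemma is_infI U x y : x :&: y \in U -> is_inf (set_struct U) x y (x :&: y).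
Proof.
move=> xyU; split=> //=; rewrite ?subsetIl ?subsetIr // => w _ xw yw.
by rewrite subsetI xw.
Qed.

(** The membership hypothesis matters: when the union lies outside [U], a supremum in [U] may exist
    and be strictly larger. *)
Lemma is_sup_eqU U x y z :
  x :|: y \in U -> is_sup (set_struct U) x y z -> z = x :|: y.
Proof.
move=> xyU [_ /= xz yz min_z]; apply/eqP.
by rewrite eqEsubset subUset xz yz min_z ?subsetUl ?subsetUr.
Qed.

Lemma is_inf_eqI U x y z :
  x :&: y \in U -> is_inf (set_struct U) x y z -> z = x :&: y.
Proof.
move=> xyU [_ /= zx zy max_z]; apply/eqP.
by rewrite eqEsubset subsetI zx zy max_z ?subsetIl ?subsetIr.
Qed.

(** De Morgan duality for the order of [U]; it applies also when the supremum is not the union. *)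
Lemma is_inf_setC U x y z :
  (forall w, w \in U -> ~: w \in U) ->
  is_sup (set_struct U) (~: x) (~: y) z -> is_inf (set_struct U) x y (~: z).
Proof.
move=> UC [/= zU xz yz min_z]; split=> /=; first exact: UC.
- by rewrite -[x]setCK setCS.
- by rewrite -[y]setCK setCS.
move=> w wU wx wy; rewrite -[w]setCK setCS.
by apply: min_z; rewrite ?setCS //; apply: UC.
Qed.

Lemma set_struct_bounded_poset U :
  set0 \in U -> setT \in U -> is_bounded_poset (set_struct U).
Proof.
move=> U0 UT; split=> //; last by move=> x _; rewrite /= sub0set subsetT.
split=> [x _|x y _ _ xyx|y x z _ _ _] /=; first exact: subxx.
- by apply/eqP; rewrite eqEsubset.
- exact: subset_trans.
Qed.

Lemma set_struct_complementation U :
  set0 \in U -> (forall x, x \in U -> ~: x \in U) ->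
  is_complementation (set_struct U).
Proof.
move=> U0 UC x xU; split=> /=; first exact: UC.
- by rewrite -(setUCr x); apply: is_supU; rewrite setUCr -setC0 UC.
- by rewrite -(setICr x); apply: is_infI; rewrite setICr.
Qed.

(** Orthogonality is disjointness, so closure under disjoint unions provides all required suprema as
    unions. The orthomodular law is then a set identity: for [x] inside [y], joining [x] with
    [~: x :&: y] gives [y]. *)
Lemma set_struct_orthomodular_poset U :
  set0 \in U -> (forall x, x \in U -> ~: x \in U) ->
  (forall x y, x \in U -> y \in U -> x \subset ~: y -> x :|: y \in U) ->
  is_orthomodular_poset (set_struct U).
Proof.
move=> U0 UC UU; have UT : setT \in U by rewrite -setC0 UC.
split.
- split; first exact: set_struct_bounded_poset.
  + exact: set_struct_complementation.
  + by move=> x y _ _ /=; rewrite setCS.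
  + by move=> x _ /=; rewrite setCK.
- by move=> x y xU yU xy; exists (x :|: y); apply: is_supU; apply: UU.
move=> x y xU yU; rewrite /= => xy; have xyU : x :|: ~: y \in U.
  by apply: UU; rewrite ?UC // setCK.
exists (x :|: ~: y); first exact: is_supU.
have yE : x :|: ~: (x :|: ~: y) = y.
  by rewrite setCU setCK setUIr setUCr setTI; apply/setUidPr.
by rewrite -[X in is_sup _ _ _ X]yE; apply: is_supU; rewrite yE.
Qed.

Lemma set_struct_boolean_algebra U :
  set0 \in U -> (forall x, x \in U -> ~: x \in U) ->
  (forall x y, x \in U -> y \in U -> x :|: y \in U) ->
  is_boolean_algebra (set_struct U).
Proof.
move=> U0 UC UU; have UT : setT \in U by rewrite -setC0 UC.
have UI x y : x \in U -> y \in U -> x :&: y \in U.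
  by move=> xU yU; rewrite -[_ :&: _]setCK setCI UC // UU // UC.
split; first exact: set_struct_bounded_poset.
- move=> x y xU yU; split; first by exists (x :|: y); apply/is_supU/UU.
  by exists (x :&: y); apply/is_infI/UI.
- move=> x y z xU yU zU yz xy xz l r.
  move=> /is_sup_eqU->; last exact: UU.
  move=> /is_inf_eqI->; last by apply: UI => //; apply: UU.
  move=> /is_inf_eqI->; last exact: UI.
  move=> /is_inf_eqI->; last exact: UI.
  move=> /is_sup_eqU->; last by apply: UU; apply: UI.
  exact: setIUr.
- exact: set_struct_complementation.
Qed.

End SetStructures.

(** * Unsplit sets and eight-element blocks *)

Section Splits.
Variable n : nat.
Implicit Types (A D S X Y : {set 'I_n}).

(** [PB k A] consists of the members of [Pnk] that do not split [A]. *)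
Definition unsplit S X := (S \subset X) || (X \subset ~: S).

Lemma unsplitC S X : unsplit S (~: X) = unsplit S X.
Proof.
rewrite /unsplit setCS orbC; congr (_ || _).
by rewrite -[in LHS](setCK S) setCS.
Qed.

Lemma unsplit0 S : unsplit S set0.
Proof. by rewrite /unsplit sub0set orbT. Qed.

Lemma unsplitU S X Y : unsplit S X -> unsplit S Y -> unsplit S (X :|: Y).
Proof.
rewrite /unsplit => /orP[SX _|XS /orP[SY|YS]].
- by rewrite (subset_trans SX) ?subsetUl.
- by rewrite (subset_trans SY) ?subsetUr.
- by rewrite subUset XS YS orbT.
Qed.

Lemma unsplit_mem S X x y :
  unsplit S X -> x \in S -> y \in S -> (x \in X) = (y \in X).
Proof.
move=> /orP[/subsetP SX|XS] xS yS; first by rewrite !SX.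
move: XS; rewrite -setCS setCK => /subsetP SX.
by have := SX _ xS; have := SX _ yS; rewrite !inE => /negbTE-> /negbTE->.
Qed.

Lemma unsplit_const S X b : {in S, forall x, (x \in X) = b} -> unsplit S X.
Proof.
rewrite /unsplit; case: b => SX; apply/orP; [left | right].
  by apply/subsetP=> x /SX.
by rewrite -setCS setCK; apply/subsetP=> x /SX; rewrite inE => ->.
Qed.

Lemma unsplit_setD A S X :
  S \subset ~: A -> unsplit S (X :\: A) = unsplit S X.
Proof.
move=> SA; rewrite /unsplit subsetD subDset disjoints_subset SA andbT.
by have /setUidPr-> : A \subset ~: S by rewrite -setCS setCK.
Qed.

Lemma unsplitI S X : unsplit S X -> X :&: S = set0 \/ X :&: S = S.
Proof.
case/orP=> [/setIidPr|]; first by right.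
by rewrite -disjoints_subset => /disjoint_setI0; left.
Qed.

(** The Boolean algebra generated by the partition [{A, D, ~: A :\: D}]. *)
Definition block A D : {set {set 'I_n}} :=
  [set X | [&& unsplit A X, unsplit D X & unsplit (~: A :\: D) X]].

Lemma block0 A D : set0 \in block A D.
Proof. by rewrite inE !unsplit0. Qed.

Lemma blockC A D X : X \in block A D -> ~: X \in block A D.
Proof. by rewrite !inE !unsplitC. Qed.

Lemma blockU A D X Y :
  X \in block A D -> Y \in block A D -> X :|: Y \in block A D.
Proof.
by rewrite !inE => /and3P[? ? ?] /and3P[? ? ?]; rewrite !unsplitU.
Qed.

Lemma blockI A D X Y :
  X \in block A D -> Y \in block A D -> X :&: Y \in block A D.
Proof.
by move=> XB YB; rewrite -[_ :&: _]setCK setCI blockC // blockU // blockC.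
Qed.

Lemma blockT A D : setT \in block A D.
Proof. by rewrite -setC0 blockC ?block0. Qed.

Lemma block_compl A D :
  D \subset ~: A -> block A (~: A :\: D) = block A D.
Proof.
move=> /setIidPr DA; apply/setP=> X.
by rewrite !inE setDDr setDv set0U DA [unsplit D X && _]andbC.
Qed.

(** Whether [D] or [~: A :\: D] is split depends only on [X :\: A], and the three listed values are
    unions of these two parts. *)
Lemma mem_block A D X :
  D \subset ~: A -> unsplit A X ->
  [\/ X :\: A = set0, X :\: A = D | X :\: A = ~: A] -> X \in block A D.
Proof.
move=> DA AX; rewrite inE AX -(unsplit_setD _ DA) -(unsplit_setD _ (subsetDl _ D)).
case=> ->; first by rewrite !unsplit0.
- by rewrite /unsplit subxx setDE setCI !setCK subsetUr orbT.
- by rewrite /unsplit DA subsetDl.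
Qed.

(** Fix points [a], [d], [e] in the three parts: a member is determined by which of them it
    contains, and all eight patterns occur. *)
Lemma card_block A D :
  D \subset ~: A -> A != set0 -> D != set0 -> ~: A :\: D != set0 ->
  #|block A D| = 8.
Proof.
move=> /subsetP DA /set0Pn[a aA] /set0Pn[d dD] /set0Pn[e eE].
pose f (b : bool * bool * bool) : {set 'I_n} :=
  [set x | if x \in A then b.1.1 else if x \in D then b.1.2 else b.2].
have dA : (d \in A) = false by have := DA _ dD; rewrite inE => /negbTE.
have [eD eA] : (e \in D) = false /\ (e \in A) = false.
  by move: eE; rewrite !inE => /andP[/negbTE-> /negbTE->].
have fK : cancel f (fun X => (a \in X, d \in X, e \in X)).
  by move=> [[b1 b2] b3]; rewrite !inE aA dA dD eA eD.
have -> : block A D = f @: setT.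
  apply/setP=> X; apply/idP/imsetP=> [|[b _ ->]].
    rewrite inE => /and3P[XA XD XE]; exists (a \in X, d \in X, e \in X) => //.
    apply/setP=> x; rewrite inE /=; case: ifP => xA.
      exact: (unsplit_mem XA).
    case: ifP => xD; first exact: (unsplit_mem XD).
    by apply: (unsplit_mem XE); rewrite // !inE xA xD.
  rewrite inE; apply/and3P; split.
  - by apply: (@unsplit_const _ _ b.1.1) => x xA; rewrite inE xA.
  - apply: (@unsplit_const _ _ b.1.2) => x xD; rewrite inE xD.
    by have := DA _ xD; rewrite inE => /negbTE->.
  - apply: (@unsplit_const _ _ b.2) => x; rewrite !inE.
    by case/andP=> /negbTE-> /negbTE->.
by rewrite card_imset ?cardsT ?card_prod ?card_bool //; apply: can_inj fK.
Qed.

End Splits.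

(** * Sizes modulo [k] and membership in [PB k A] *)

Section Pasting.
Variables (n k : nat) (A : {set 'I_n}).
Hypotheses (k_gt0 : 0 < k) (n_eq : n = 3 * k) (cardA : #|A| = k).
Implicit Types (C D E X Y : {set 'I_n}).

Lemma card_setC X : #|~: X| = 3 * k - #|X|.
Proof. by rewrite cardsCs setCK card_ord; congr (_ - _). Qed.

Lemma card_le_3k X : #|X| <= 3 * k.
Proof. by rewrite -n_eq -[n in _ <= n]card_ord max_card. Qed.

Lemma card_setCA : #|~: A| = 2 * k.
Proof. by rewrite card_setC cardA -[k in _ - k]mul1n -mulnBl. Qed.

Lemma A_neq0 : A != set0.
Proof. by rewrite -card_gt0 cardA. Qed.

(** An unsplit [C] meets [A] in 0 or [k] points, so divisibility of its size is decided outside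
    [A]. *)
Lemma mem_PB C : (C \in PB k A) = unsplit A C && (k %| #|C :\: A|).
Proof.
rewrite /PB /Pnk !inE andbC -/(unsplit A C); case AC: (unsplit A C) => //=.
rewrite -(cardsID A C) dvdn_addr //.
by case: (unsplitI AC) => ->; rewrite ?cards0 ?dvdn0 ?cardA.
Qed.

Lemma setC_multiple (u : {set 'I_n}) : u \subset ~: A -> k %| #|u| ->
  [\/ u = set0, #|u| = k | u = ~: A].
Proof.
move=> uA /dvdnP[[|[|j]] cu].
- by constructor 1; apply/eqP; rewrite -cards_eq0 cu.
- by constructor 2; rewrite cu mul1n.
- constructor 3; apply/eqP; rewrite eqEcard uA card_setCA cu leq_mul2r.
  by rewrite orbT.
Qed.

Lemma setD_sub_setC X : X :\: A \subset ~: A.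
Proof. by rewrite setDE subsetIr. Qed.

Lemma PB_setD X : X \in PB k A ->
  [\/ X :\: A = set0, #|X :\: A| = k | X :\: A = ~: A].
Proof.
by rewrite mem_PB => /andP[_]; apply: setC_multiple; apply: setD_sub_setC.
Qed.

Lemma PB_unsplit X : X \in PB k A -> unsplit A X.
Proof. by rewrite mem_PB => /andP[]. Qed.

Lemma PB0 : set0 \in PB k A.
Proof. by rewrite mem_PB unsplit0 set0D cards0 dvdn0. Qed.

Lemma Pnk_setC X : X \in Pnk n k -> ~: X \in Pnk n k.
Proof.
by rewrite !inE => kX; rewrite card_setC dvdn_subr ?card_le_3k ?dvdn_mull.
Qed.

Lemma PB_setC X : X \in PB k A -> ~: X \in PB k A.
Proof.
rewrite inE => /andP[XP XA]; rewrite inE (Pnk_setC XP).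
by rewrite -/(unsplit A (~: X)) unsplitC.
Qed.

Lemma Pnk_setU X Y : X \in Pnk n k -> Y \in Pnk n k -> X \subset ~: Y ->
  X :|: Y \in Pnk n k.
Proof.
rewrite !inE -disjoints_subset => kX kY /disjoint_setI0 XY.
by rewrite cardsU XY cards0 subn0 dvdn_add.
Qed.

Lemma PB_setU X Y : X \in PB k A -> Y \in PB k A -> X \subset ~: Y ->
  X :|: Y \in PB k A.
Proof.
move=> XP YP XY; have [AX AY] := (PB_unsplit XP, PB_unsplit YP).
move: XP YP; rewrite !inE => /andP[kX _] /andP[kY _].
rewrite -/(unsplit A (X :|: Y)) unsplitU // andbT.
by have := @Pnk_setU X Y; rewrite !inE; apply.
Qed.

(** * Orthomodularity and lattice operations *)

Lemma Pnk_orthomodular_poset : is_orthomodular_poset (set_struct (Pnk n k)).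
Proof.
apply: set_struct_orthomodular_poset; first by rewrite inE cards0 dvdn0.
- exact: Pnk_setC.
- exact: Pnk_setU.
Qed.

Lemma PB_orthomodular_poset : is_orthomodular_poset (set_struct (PB k A)).
Proof.
exact: (set_struct_orthomodular_poset PB0 PB_setC PB_setU).
Qed.

Lemma setD_dvd_PB X : X \in PB k A -> k %| #|X :\: A|.
Proof. by rewrite mem_PB => /andP[]. Qed.

(** If [X :|: Y] is not in [PB k A], then [(X :|: Y) :\: A] has more than [k]
    elements, so that every upper bound contains [~: A]. *)
Lemma PB_sup X Y : X \in PB k A -> Y \in PB k A ->
  exists Z, is_sup (set_struct (PB k A)) X Y Z.
Proof.
move=> XP YP; have AXY := unsplitU (PB_unsplit XP) (PB_unsplit YP).
have [XYP|XYnP] := boolP (X :|: Y \in PB k A).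
  by exists (X :|: Y); apply: is_supU.
have ZP : (X :|: Y) :|: ~: A \in PB k A.
  rewrite mem_PB unsplitU //; last by rewrite /unsplit subxx orbT.
  have -> : (X :|: Y :|: ~: A) :\: A = ~: A.
    by rewrite setDE setIUl setIid; apply/setUidPr; apply: subsetIr.
  by rewrite card_setCA dvdn_mull.
exists (X :|: Y :|: ~: A); split=> //=; try by rewrite -setUA ?subsetUl.
  by rewrite setUAC subsetUr.
move=> W WP XW YW; rewrite !subUset XW YW /=.
have XYW : (X :|: Y) :\: A \subset W :\: A by rewrite setSD // subUset XW.
have nk : ~~ (k %| #|(X :|: Y) :\: A|).
  by apply: contra XYnP => kXY; rewrite mem_PB AXY.
case: (PB_setD WP) => cW.
- by move: XYW nk; rewrite cW subset0 => /eqP->; rewrite cards0 dvdn0.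
(* If [W :\: A] has [k] points, then [X :\: A] and [Y :\: A] are each empty or equal to it, so [k]
   divides the size of their union, against [nk]. *)
- case/negP: nk; rewrite setDUl.
  have small V : V \in PB k A -> V \subset W ->
      V :\: A = set0 \/ V :\: A = W :\: A.
    move=> VP VW; have VWA : V :\: A \subset W :\: A by rewrite setSD.
    case: (PB_setD VP) => [->|cV|eV]; [by left | right.. ]; apply/eqP.
      by rewrite eqEcard VWA cV cW /=.
    by rewrite eqEsubset VWA eV setD_sub_setC.
  case: (small X XP XW) => ->; first by rewrite set0U setD_dvd_PB.
  case: (small Y YP YW) => ->; first by rewrite setU0 setD_dvd_PB.
  by rewrite setUid setD_dvd_PB.
- by rewrite -cW subsetDl.
Qed.

Lemma PB_lattice : has_lattice_ops (set_struct (PB k A)).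
Proof.
move=> X Y XP YP; split; first exact: PB_sup.
have [Z supZ] := PB_sup (PB_setC XP) (PB_setC YP).
by exists (~: Z); apply: is_inf_setC supZ; apply: PB_setC.
Qed.

(** * Cardinality of [PB k A] *)

Lemma card_PB : #|PB k A| = 4 + 2 * 'C(2 * k, k).
Proof.
pose V := [set u : {set 'I_n} | u \subset ~: A & k %| #|u|].
pose W := [set u : {set 'I_n} | u \subset ~: A & #|u| == k].
(* The possible traces on [~: A] are the empty set, [~: A] itself and the [k]-subsets. *)
have cV : #|V| = 2 + 'C(2 * k, k).
  have -> : V = set0 |: (~: A |: W).
    apply/setP=> u; rewrite !inE; apply/idP/idP=> [/andP[uA /(setC_multiple uA)]|].
      by case=> [->|->|->]; rewrite ?eqxx ?uA ?orbT.
    case/or3P=> [/eqP->|/eqP->|/andP[-> /eqP->]]; last exact: dvdnn.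
      by rewrite sub0set cards0 dvdn0.
    by rewrite subxx card_setCA dvdn_mull.
  have A'W : ~: A \notin W.
    rewrite inE card_setCA subxx gtn_eqF // mul2n -addnn.
    by rewrite -[X in X < _]add0n ltn_add2r.
  have W0 : set0 \notin ~: A |: W.
    rewrite !inE negb_or eq_sym -card_gt0 card_setCA muln_gt0 k_gt0.
    by rewrite sub0set cards0 eq_sym -lt0n.
  by rewrite !cardsU1 A'W W0 cards_draws card_setCA addnA.
(* [f] rebuilds a set from the bit telling whether it contains [A] and from its trace; [fA] and [fD]
   recover the two, the bit because [A] is nonempty. *)
pose f (b : bool * {set 'I_n}) := (if b.1 then A else set0) :|: b.2.
have fD b (u : {set 'I_n}) : u \subset ~: A -> f (b, u) :\: A = u.
  move=> uA; rewrite /f setDUl /=.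
  have -> : (if b then A else set0) :\: A = set0.
    by case: b; rewrite ?setDv ?set0D.
  by rewrite set0U setDE; apply/setIidPl.
have fA b (u : {set 'I_n}) : u \subset ~: A -> (A \subset f (b, u)) = b.
  move=> uA; case: b; rewrite /f /= ?subsetUl // set0U.
  apply: contraNF A_neq0 => Au; rewrite -subset0 -(setICr A) subsetI subxx.
  exact: subset_trans uA.
have -> : PB k A = f @: setX setT V.
  apply/setP=> X; apply/idP/imsetP=> [XP|[[b u]]].
    exists (A \subset X, X :\: A).
      by rewrite !inE setD_sub_setC setD_dvd_PB.
    rewrite /f /=; case: ifP (PB_unsplit XP) => AX.
      by move=> _; rewrite -{1}(setID X A) (setIidPr AX).
    by rewrite /unsplit AX set0U setDE => /setIidPl.
  case/setXP=> _; rewrite inE => /andP[uA ku] ->.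
  rewrite mem_PB fD // ku andbT /unsplit fA //; case: b => //=.
  by rewrite /f /= set0U.
rewrite card_in_imset.
  by rewrite cardsX cardsT card_bool cV mulnDr.
move=> [b u] [c v]; rewrite !inE /= => /andP[uA _] /andP[vA _] fE.
congr pair; first by rewrite -(fA b u uA) fE fA.
by rewrite -(fD b u uA) fE fD.
Qed.

(** * The pasting of the blocks *)

Lemma card_setCAD D : D \subset ~: A -> #|D| = k -> #|~: A :\: D| = k.
Proof. by move=> DA cD; rewrite cardsDS // card_setCA cD mul2n -addnn addnK. Qed.

(** The trace [X :\: A] falls into pieces in [D] and in [~: A :\: D], each empty or with [k]
    points. *)
Lemma block_sub_PB D :
  D \subset ~: A -> #|D| = k -> {subset block A D <= PB k A}.
Proof.
move=> DA cD X; rewrite inE mem_PB => /and3P[-> XD XE] /=.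
rewrite -(unsplit_setD _ DA) in XD.
rewrite -(unsplit_setD _ (subsetDl _ D)) in XE.
rewrite -(cardsID D) dvdn_add //.
  by case: (unsplitI XD) => ->; rewrite ?cards0 ?dvdn0 ?cD.
have -> : (X :\: A) :\: D = (X :\: A) :&: (~: A :\: D).
  by rewrite setIDA (setIidPl (setD_sub_setC X)).
by case: (unsplitI XE) => ->; rewrite ?cards0 ?dvdn0 ?card_setCAD.
Qed.

(** Take as [D] the trace of [Y] or else that of [X], whichever has [k] points; if neither has, any
    [k]-subset of [~: A] will do. This gives the order condition of the pasting and, for [X = Y],
    the covering by blocks. *)
Lemma PB_common_block X Y : X \in PB k A -> Y \in PB k A -> X \subset Y ->
  exists D, [/\ D \subset ~: A, #|D| = k, X \in block A D & Y \in block A D].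
Proof.
move=> XP YP XY; have XYA : X :\: A \subset Y :\: A by rewrite setSD.
have [AX AY] := (PB_unsplit XP, PB_unsplit YP).
have DA := setD_sub_setC.
have [D0 DA0 cD0] : exists2 D : {set 'I_n}, D \subset ~: A & #|D| = k.
  by apply: exists_subset_card; rewrite card_setCA leq_pmull.
case: (PB_setD YP) => cY.
- exists D0; split=> //; apply: mem_block => //; constructor 1 => //.
  by apply/eqP; rewrite -subset0 -cY.
- exists (Y :\: A); split=> //; apply: mem_block; rewrite ?DA //.
    case: (PB_setD XP) => cX; [by constructor 1 | constructor 2 | ].
      by apply/eqP; rewrite eqEcard XYA cX cY /=.
    by constructor 3.
  by constructor 2.
- case: (PB_setD XP) => cX.
  + exists D0; split=> //; apply: mem_block => //; first by constructor 1.
    by constructor 3.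
  + exists (X :\: A); split=> //; apply: mem_block; rewrite ?DA //.
      by constructor 2.
    by constructor 3.
  + by exists D0; split=> //; apply: mem_block => //; constructor 3.
Qed.

(** Unions and intersections of members stay in the block, hence in [PB k A], so they are the
    suprema and infima of [PB k A]. *)
Lemma block_boolean_subalgebra D : D \subset ~: A -> #|D| = k ->
  is_boolean_subalgebra (set_struct (PB k A)) (block A D).
Proof.
move=> DA cD; have BP := block_sub_PB DA cD.
split=> //.
- by split; [apply: block0 | apply: blockT].
- by move=> X; apply: blockC.
- move=> X Y XB YB Z [/is_sup_eqU|/is_inf_eqI] ->.
  + exact: blockU.
  + by apply: BP; apply: blockU.
  + exact: blockI.
  + by apply: BP; apply: blockI.
apply: (@set_struct_boolean_algebra n (block A D)); first exact: block0.
- exact: blockC.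
- exact: blockU.
Qed.

Lemma block_atom D : D \subset ~: A ->
  is_atom (restr (set_struct (PB k A)) (block A D)) A.
Proof.
move=> DA; split.
- apply: mem_block => //; first by rewrite /unsplit subxx.
  by constructor 1; rewrite setDv.
- by apply/eqP; apply: A_neq0.
move=> X /=; rewrite inE => /and3P[/orP[AX|XA] _ _] XsA.
  by right; apply/eqP; rewrite eqEsubset XsA.
by left; apply/eqP; rewrite -subset0 -(setICr A) subsetI XsA.
Qed.

(** Having the same size as [D] but differing from it, [E] contains a point outside [D] besides the
    common point [a]. A set splitting none of [D], [E], [~: A :\: D] therefore does not split
    [~: A]; as it does not split [A] either, four sets remain. *)
Lemma blockI_trivial a D E X :
  D \subset ~: A -> E \subset ~: A -> #|D| = k -> #|E| = k ->
  a \in D -> a \in E -> D <> E ->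
  (X \in block A D) && (X \in block A E) <->
  [\/ X = set0, X = A, X = ~: A | X = setT].
Proof.
move=> DA EA cD cE aD aE neq; split.
  rewrite !inE => /andP[/and3P[AX DX D'X] /and3P[_ EX _]].
  have [e eE eD] : exists2 e, e \in E & e \notin D.
    apply/subsetPn; apply/negP=> ED; apply: neq; apply/esym/eqP.
    by rewrite eqEcard ED cD cE /=.
  have A'X : unsplit (~: A) X.
    apply: (@unsplit_const _ _ _ (a \in X)) => x xA.
    have [xD|xD] := boolP (x \in D); first exact: (unsplit_mem DX).
    rewrite (unsplit_mem EX aE eE); apply: (unsplit_mem D'X).
      by rewrite inE xD.
    by rewrite inE eD (subsetP EA).
  case/orP: AX => [AX|XA]; case/orP: A'X => [A'X|XA'].
  - constructor 4; apply/eqP; rewrite -subTset -(setUCr A).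
    by rewrite subUset AX.
  - by constructor 2; apply/eqP; rewrite eqEsubset AX -[A]setCK XA'.
  - by constructor 3; apply/eqP; rewrite eqEsubset XA.
  - constructor 1; apply/eqP; rewrite -subset0 -(setICr A) subsetI XA.
    by rewrite -[A]setCK XA'.
have AA D' : D' \subset ~: A -> A \in block A D'.
  move=> D'A; apply: mem_block => //; first by rewrite /unsplit subxx.
  by constructor 1; rewrite setDv.
by case=> ->; rewrite ?block0 ?blockT ?AA ?blockC ?AA.
Qed.

(** The [k]-subsets of [~: A] containing a given point: one out of each pair
    [{D, ~: A :\: D}]. *)
Definition block_index (a : 'I_n) : {set {set 'I_n}} :=
  [set D : {set 'I_n} | [&& D \subset ~: A, #|D| == k & a \in D]].

(** Complementation in [~: A] exchanges the [k]-subsets containing [a] with those avoiding it. *)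
Lemma card_block_index a : a \in ~: A -> #|block_index a| * 2 = 'C(2 * k, k).
Proof.
move=> aA; pose W := [set u : {set 'I_n} | u \subset ~: A & #|u| == k].
pose S := [set u : {set 'I_n} | a \in u].
have <- : #|W| = 'C(2 * k, k) by rewrite cards_draws card_setCA.
have iE : block_index a = W :&: S by apply/setP=> D; rewrite !inE andbA.
have invD D : D \subset ~: A -> ~: A :\: (~: A :\: D) = D.
  by move=> DA; rewrite setDDr setDv set0U; apply/setIidPr.
rewrite -(cardsID S W) -iE.
have -> : W :\: S = (fun D => ~: A :\: D) @: block_index a.
  apply/setP=> D; apply/idP/imsetP=> [|[E]].
    rewrite !inE => /and3P[aD DA /eqP cD]; exists (~: A :\: D).
      rewrite inE subsetDl card_setCAD // eqxx inE aA andbT.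
      exact: aD.
    by rewrite invD.
  rewrite !inE => /and3P[EA /eqP cE aE] ->.
  by rewrite subsetDl card_setCAD // eqxx !inE aE.
rewrite card_in_imset ?muln2 ?addnn //.
move=> D E; rewrite !inE => /and3P[DA _ _] /and3P[EA _ _] DE.
by rewrite -(invD D) // DE invD.
Qed.

Lemma block_index_block a D : a \in ~: A -> D \subset ~: A -> #|D| = k ->
  exists2 E, E \in block_index a & block A E = block A D.
Proof.
move=> aA DA cD; have [aD|aD] := boolP (a \in D).
  by exists D; rewrite // inE DA cD eqxx.
exists (~: A :\: D); last exact: block_compl.
by rewrite inE subsetDl card_setCAD // eqxx inE aD.
Qed.

Lemma PB_atomic_pasting : exists (m : nat) (F : 'I_m -> {pred {set 'I_n}}),
  [/\ m * 2 = 'C(2 * k, k), forall i, #|F i| = 8 &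
      is_atomic_pasting (set_struct (PB k A)) F A].
Proof.
have [a aA] : exists a, a \in ~: A.
  by apply/set0Pn; rewrite -card_gt0 card_setCA muln_gt0.
pose I := block_index a.
have IP (i : 'I_#|I|) :
    [/\ enum_val i \subset ~: A, #|enum_val i| = k & a \in enum_val i].
  by have := enum_valP i; rewrite inE => /and3P[? /eqP].
have block_i D : D \subset ~: A -> #|D| = k ->
    exists i : 'I_#|I|, block A (enum_val i) = block A D.
  move=> DA cD; have [E EI <-] := block_index_block aA DA cD.
  by exists (enum_rank_in EI E); rewrite enum_rankK_in.
exists #|I|, (fun i => block A (enum_val i) : {pred {set _}}); split.
- exact: card_block_index.
- move=> i; have [DA cD _] := IP i.
  apply: card_block => //; first exact: A_neq0.
    by rewrite -card_gt0 cD.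
  by rewrite -card_gt0 card_setCAD.
split; first by split; [apply: PB_orthomodular_poset | apply: PB_lattice].
split.
- move=> i; have [DA cD _] := IP i; split; last exact: block_atom.
  exact: block_boolean_subalgebra.
- move=> X; split=> [XP|[i]].
    have [D [DA cD XD _]] := PB_common_block XP XP (subxx X).
    by have [i iE] := block_i D DA cD; exists i; rewrite /= iE.
  by have [DA cD _] := IP i; apply: block_sub_PB.
- move=> i j neq X; have [DA cD aD] := IP i; have [EA cE aE] := IP j.
  (* The shared point [a] excludes the case of complementary [D] and [E], which would generate the
     same block. *)
  apply: (blockI_trivial _ DA EA cD cE aD aE).
  by move/enum_val_inj.
move=> X Y XP YP; split=> [XY|[i []] //].
have [D [DA cD XD YD]] := PB_common_block XP YP XY.
by have [i iE] := block_i D DA cD; exists i; rewrite /= iE.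
Qed.

(** * The sublattice property and maximality *)

Lemma PB_om_sublattice :
  is_om_sublattice (set_struct (Pnk n k)) (car (set_struct (PB k A))).
Proof.
split; first exact: Pnk_orthomodular_poset.
split; last exact: PB_lattice.
- by move=> X; rewrite /= inE => /andP[].
- by split; [apply: PB0 | rewrite /= -setC0; apply/PB_setC/PB0].
- by move=> X; apply: PB_setC.
move=> X Y XP YP XY Z /is_sup_eqU->; first exact: PB_setU.
have := PB_setU XP YP XY.
by rewrite inE => /andP[].
Qed.

Lemma om_sublattice_card_k (S : {pred {set 'I_n}}) C :
  is_om_sublattice (set_struct (Pnk n k)) S -> {subset PB k A <= S} ->
  C \in S -> #|C| = k -> C \in PB k A.
Proof.
move=> [_ [SP _ SC _ Slat]] PS CS cC; apply/negPn/negP=> CnP.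
have kC : C \in Pnk n k by apply: SP.
have [AC CA] : ~~ (A \subset C) /\ ~~ (C \subset ~: A).
  by apply/norP; move: CnP; rewrite inE kC.
have A'S : ~: A \in S.
  apply: PS; rewrite mem_PB /unsplit subxx orbT.
  by rewrite setDE setIid card_setCA dvdn_mull.
(* As [C] meets [A], fewer than [k] of the [2 * k] points of [~: A] lie in [C]. *)
have cR : k < #|~: A :\: C|.
  have lt_CA : #|C :\: A| < k.
    rewrite -cC; apply: proper_card; rewrite properEneq subsetDl andbT.
    apply: contraNneq CA => <-; exact: setD_sub_setC.
  rewrite cardsD card_setCA setIC -setDE mul2n -addnn.
  by rewrite ltn_subRL // ltn_add2r.
have [D1 D1R cD1] := exists_subset_card (ltnW cR).
(* Putting [x] into [D2] forces any common upper bound of [D1] and [D2] to have more than [k]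
   points. *)
have [x xR xD1] : exists2 x, x \in ~: A :\: C & x \notin D1.
  by apply/subsetPn; apply: contraTN cR => /subset_leq_card; rewrite cD1 leqNgt.
have [D2 [D2R cD2 xD2]] : exists D2 : {set 'I_n},
    [/\ D2 \subset ~: A :\: C, #|D2| = k & x \in D2].
  by apply: exists_subset_card_mem; rewrite // k_gt0 ltnW.
have RS D : D \subset ~: A :\: C -> #|D| = k -> D \in S.
  move=> DR cD; apply: PS; have DA := subset_trans DR (subsetDl _ _).
  by rewrite inE DA orbT inE cD dvdnn.
(* This supremum is taken in [S], so it is compared only with upper bounds in [S]; [~: A] and [~: C]
   are such bounds. *)
have [[Z [/= ZS D1Z D2Z minZ]] _] := Slat _ _ (RS _ D1R cD1) (RS _ D2R cD2).
have ZA : Z \subset ~: A.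
  by apply: minZ => //; apply: (subset_trans _ (subsetDl _ C)).
have ZC : Z \subset ~: C.
  have RC : ~: A :\: C \subset ~: C by rewrite setDE subsetIr.
  by apply: minZ; [apply: SC | apply: subset_trans RC..].
have cZ : k < #|Z|.
  have : x |: D1 \subset Z by rewrite subUset sub1set D1Z (subsetP D2Z).
  by move/subset_leq_card; rewrite cardsU1 xD1 cD1.
have ZE : Z = ~: A.
  move/SP: (ZS); rewrite inE => /(setC_multiple ZA)[Z0|Zk|//].
    by move: cZ; rewrite Z0 cards0.
  by move: cZ; rewrite Zk ltnn.
(* Now [~: A = Z] lies in [~: C], so [C] lies in [A] and equals it by size, yet [A] belongs to
   [PB k A]. *)
case/negP: CnP; have -> : C = A; last first.
  by rewrite mem_PB /unsplit subxx setDv cards0 dvdn0.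
by apply/eqP; rewrite eqEcard cC cardA leqnn andbT -setCS -ZE.
Qed.

(** Members of [Pnk] have size 0, [k], [2 * k] or [3 * k]; [om_sublattice_card_k] settles size [k],
    and complementation reduces the last two sizes to [k] and 0. *)
Lemma PB_maximal_om_sublattice :
  is_maximal_om_sublattice (set_struct (Pnk n k)) (car (set_struct (PB k A))).
Proof.
split=> [|S Ssub PS C]; first exact: PB_om_sublattice.
apply/idP/idP=> [CS|]; last exact: PS.
change (C \in PB k A); have [_ [SP _ SC _ _]] := Ssub.
have /SP := CS; rewrite inE => /dvdnP[[|[|[|j]]] cC].
- by move/eqP: cC; rewrite cards_eq0 => /eqP->; apply: PB0.
- by apply: (om_sublattice_card_k Ssub PS CS); rewrite cC mul1n.
- rewrite -[C]setCK; apply: PB_setC; apply: (om_sublattice_card_k Ssub PS).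
    exact: SC.
  by rewrite card_setC cC -mulnBl mul1n.
rewrite -[C]setCK; apply: PB_setC.
have /eqP : #|~: C| = 0.
  by apply/eqP; rewrite card_setC subn_eq0 cC leq_mul2r orbT.
by rewrite cards_eq0 => /eqP->; apply: PB0.
Qed.

End Pasting.

(** Since [C] is in [PB k B], it equals [B] or is disjoint from it. In the disjoint case some
    [k]-set avoiding [B] splits [C], so it lies in [PB k B] but not in [PB k C]. *)
Lemma PB_inj (n k : nat) (B C : {set 'I_n}) :
  1 < k -> n = 3 * k -> #|B| = k -> #|C| = k -> PB k B =i PB k C -> B = C.
Proof.
move=> k_gt1 n_eq cB cC BC; have k_gt0 := ltnW k_gt1.
have : C \in PB k B by rewrite BC !inE cC dvdnn subxx.
rewrite !inE => /andP[_ /orP[sBC|CB]].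
  by apply/eqP; rewrite eqEcard sBC cB cC /=.
(* exchange a point [c] of [C] for a point [e] outside [B :|: C] *)
have [c cinC] : exists c, c \in C by apply/set0Pn; rewrite -card_gt0 cC.
have [e eBC] : exists e, e \in ~: (B :|: C).
  apply/set0Pn; rewrite -card_gt0 (card_setC n_eq) subn_gt0.
  rewrite (leq_ltn_trans (leq_card_setU B C)) // cB cC addnn -mul2n.
  by rewrite ltn_mul2r k_gt0.
move: eBC; rewrite !inE negb_or => /andP[eB eC].
have cCc : #|C :\ c|.+1 = k by rewrite -cC (cardsD1 c C) cinC.
have DB : e |: (C :\ c) \in PB k B.
  rewrite !inE cardsU1 !inE (negbTE eC) andbF add1n cCc dvdnn.
  rewrite subUset sub1set inE eB (subset_trans _ CB) ?orbT //.
  exact: subD1set.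
move: DB; rewrite BC inE => /andP[_ /orP[/subsetP/(_ _ cinC)|]].
  by rewrite !inE eqxx orbF => /eqP ce; rewrite -ce cinC in eC.
(* Here [1 < k] leaves a point of [C] after the removal of [c]. *)
have [d dC] : exists d, d \in C :\ c.
  by apply/set0Pn; rewrite -card_gt0 -ltnS cCc.
move/subsetP/(_ d); rewrite !in_setU dC orbT => /(_ isT).
by move: dC; rewrite !inE => /andP[_ ->].
Qed.

Theorem theorem5p7 (n k : nat) (hk : 1 < k) (hn : n = 3 * k)
    (A : {set 'I_n}) (hA : A \in Q n k) :
  [/\ is_maximal_om_sublattice (set_struct (Pnk n k)) (car (set_struct (PB k A))),
      #|PB k A| = 4 + 2 * 'C(2 * k, k),
      exists (m : nat) (F : 'I_m -> {pred {set 'I_n}}),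
        [/\ m * 2 = 'C(2 * k, k),
            forall i, #|F i| = 8 &
            is_atomic_pasting (set_struct (PB k A)) F A] &
      forall B C : {set 'I_n}, B \in Q n k -> C \in Q n k -> B <> C ->
        set_struct (PB k B) <> set_struct (PB k C)].
Proof.
have k_gt0 := ltnW hk; move: hA; rewrite inE => /eqP cA; split.
- exact: PB_maximal_om_sublattice.
- exact: card_PB.
- exact: PB_atomic_pasting.
move=> B C; rewrite !inE => /eqP cB /eqP cC neq PBC; apply: neq.
apply: PB_inj hk hn cB cC _ => D.
exact: (congr1 (fun P : ostruct {set 'I_n} => D \in car P) PBC).
Qed.
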